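(* Let $A_1,\dots,A_d$ be events, $Y$ a square-integrable real random variable, and $n\in\{1,\dots,d\}$. For $I\subset\{1,\dots,d\}$ with $|I|=n$ set $$B_I=\bigcap_{j\in I}A_j,\qquad C_I=\bigcap_{k\notin I,\;k<\max I}A_k^c,$$ and assume $\mathbb{P}(B_I)>0$ for all such $I$. Consider the two estimators of $\beta_n=\mathbb{E}[Y\,\mathbf{1}\{\sum_{i=1}^d\mathbf{1}\{A_i\}\ge n\}]$ $$\hat\beta_n=\sum_{|I|=n}\mathbb{P}(B_I)\,W_I,\qquad \hat\beta_n^{[0]}=\sum_{|I|=n}V_I,$$ where the $W_I$ ($|I|=n$) are independent and $W_I$ has the distribution of $Y\,\mathbf{1}\{C_I\}$ under $\mathbb{P}(\,\cdot\mid B_I)$, and the $V_I$ ($|I|=n$) are independent and $V_I$ has the distribution of $Y\,\mathbf{1}\{B_I\cap C_I\}$ under $\mathbb{P}$. Then $$\operatorname{Var}(\hat\beta_n)\le\Big(\max_{|I|=n}\mathbb{P}(B_I)\Big)\operatorname{Var}\big(\hat\beta_n^{[0]}\big).$$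
   Context: Here $\mathbf{1}\{\cdot\}$ denotes the indicator function; sums and maxima over $|I|=n$ run over all subsets $I$ of $\{1,\dots,d\}$ of cardinality $n$, and an empty intersection of events is the whole sample space. No independence is assumed among the events $A_i$ or between them and $Y$. *)

(* Defs.v *)
From HB Require Import structures.
From mathcomp Require Import all_boot all_order all_algebra.
From mathcomp Require Import all_classical all_reals all_analysis.

Set Implicit Arguments.
Unset Strict Implicit.
Unset Printing Implicit Defensive.

Import Order.TTheory GRing.Theory Num.Theory.

Local Open Scope classical_set_scope.
Local Open Scope ring_scope.
Local Open Scope ereal_scope.

Definition cond_prob (disp : measure_display) (T : measurableType disp)
    (R : realType) (P : probability T R) (B : set T) : set T -> \bar R :=
  fun E => P (E `&` B) / P B.

(* [mu] is a bare set function so that [X] may live under [cond_prob P B] as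
   well as under a [probability]. *)
Definition has_law_of (disp1 disp2 : measure_display)
    (T1 : measurableType disp1) (T2 : measurableType disp2) (R : realType)
    (Q : probability T1 R) (Z : {RV Q >-> R})
    (mu : set T2 -> \bar R) (X : T2 -> R) : Prop :=
  forall E : set R, measurable E -> distribution Q Z E = pushforward mu X E.

(* Mutual independence of the subfamily (X i), i in D; the members of X with
   index outside D are unconstrained. *)
Definition mutually_independent (disp : measure_display)
    (T : measurableType disp) (R : realType) (Q : probability T R)
    (K : finType) (D : {set K}) (X : K -> {RV Q >-> R}) : Prop :=
  forall (J : {set K}) (E : K -> set R), J \subset D ->
    (forall i, i \in J -> measurable (E i)) ->
    Q (\bigcap_(i in [set` J]) X i @^-1` E i) =
    \prod_(i in J) Q (X i @^-1` E i).

Definition B_ (T : Type) (d : nat) (A : 'I_d -> set T) (I : {set 'I_d}) :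
    set T :=
  \bigcap_(j in [set` I]) A j.

(* {1, ..., d} is encoded as 'I_d = {0, ..., d-1}; the bound k < max I is
   invariant under the shift.  The value 0 of the maximum at I = set0 is
   irrelevant: only nonempty I are used. *)
Definition C_ (T : Type) (d : nat) (A : 'I_d -> set T) (I : {set 'I_d}) :
    set T :=
  \bigcap_(k in [set k : 'I_d | k \notin I /\ (k < \max_(i in I) i)%N]) ~` A k.

(* Main.v *)
(** Off 0, the law of V_I is P(B_I) times the law of W_I, so for f(0) = 0 the
    expectation of f(V_I) is P(B_I) times that of f(W_I).  With p = P(B_I),
    m = E[V_I] and s = E[V_I^2], this gives
    Var(p W_I) = p s - m^2 <= p (s - m^2) = p Var(V_I) because p <= 1.
    Independence makes the variance of each estimator the sum of the variances
    of its terms, whence the bound. *)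

Require Import Defs.
From HB Require Import structures.
From mathcomp Require Import all_boot all_order all_algebra.
From mathcomp Require Import all_classical all_reals all_analysis.
From mathcomp Require Import measurable_realfun ring.

Set Implicit Arguments.
Unset Strict Implicit.
Unset Printing Implicit Defensive.

Import Order.TTheory GRing.Theory Num.Theory.

Local Open Scope classical_set_scope.
Local Open Scope ring_scope.
Local Open Scope ereal_scope.

(** * Square integrability, and expectations under laws proportional off 0 *)

Lemma Lfun2P (R : realType) d (T : measurableType d)
    (mu : {measure set T -> \bar R}) (f : T -> R) : measurable_fun setT f ->
  f \in Lfun mu 2%:E <-> \int[mu]_x (f x ^+ 2)%:E < +oo.
Proof.
move=> mf; split=> [/Lfun2_integrable_sqr/integrableP[_]|foo].
  by under eq_integral do rewrite /= ger0_norm ?sqr_ge0//.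
rewrite inE; apply/andP; split; rewrite inE//=.
rewrite /finite_norm unlock /Lnorm poweR_lty//.
rewrite (_ : (\int[mu]_x _) = \int[mu]_x (f x ^+ 2)%:E)//.
apply: eq_integral => x _ /=.
by rewrite powR_mulrn ?normr_ge0// real_normK ?num_real.
Qed.

(** As [f] vanishes at 0, both expectations are integrals of [f] over the complement of 0, where the
    law of [Z] is [p] times that of [X]. At 0 itself the laws need not match, since their total
    masses [p] and 1 may differ. *)
Lemma expectation_scaled_law (R : realType) d1 d2 (T1 : measurableType d1)
    (T2 : measurableType d2) (P1 : probability T1 R) (P2 : probability T2 R)
    (X : {RV P1 >-> R}) (Z : {RV P2 >-> R}) (p : {nonneg R}) (f : R -> R) :
  (forall E : set R, measurable E -> ~ E 0%R ->
    p%:num%:E * distribution P1 X E = distribution P2 Z E) ->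
  measurable_fun setT f -> (forall x, 0 <= f x)%R -> f 0%R = 0%R ->
  p%:num%:E * 'E_P1[f \o X] = 'E_P2[f \o Z].
Proof.
move=> XZ mf f0 f00.
have mEf : measurable_fun [set: R] (EFin \o f) by exact/measurable_EFinP.
have integral_off0 (mu : {measure set R -> \bar R}) :
    \int[mu]_x (f x)%:E = \int[mu]_(x in ~` [set 0%R]) (f x)%:E.
  rewrite [RHS]integral_mkcond; apply: eq_integral => x _.
  rewrite patchE; case: ifPn => //; rewrite notin_setE/= => /contrapT ->.
  by rewrite f00.
rewrite unlock -(ge0_integral_distribution X mEf)//=.
rewrite -(ge0_integral_distribution Z mEf)//=.
rewrite -ge0_integral_mscale//=; last by move=> x _; rewrite lee_fin.
(* The measures need only agree on measurable subsets of the complement of 0. *)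
rewrite !integral_off0; apply: eq_measure_integral => E mE E0.
by apply: XZ => // /E0; exact.
Qed.

(** The nonnegative case applies to the positive and negative parts, both given by functions
    vanishing at 0. *)
Lemma expectation_scaled_law_id (R : realType) d1 d2 (T1 : measurableType d1)
    (T2 : measurableType d2) (P1 : probability T1 R) (P2 : probability T2 R)
    (X : {RV P1 >-> R}) (Z : {RV P2 >-> R}) (p : {nonneg R}) :
  (forall E : set R, measurable E -> ~ E 0%R ->
    p%:num%:E * distribution P1 X E = distribution P2 Z E) ->
  (X : T1 -> R) \in Lfun P1 1 ->
  p%:num%:E * 'E_P1[X] = 'E_P2[Z].
Proof.
move=> XZ X1.
have posE d (T : measurableType d) (Q : probability T R) (U : {RV Q >-> R}) :
    'E_Q[U] = 'E_Q[(fun x => Num.max x 0)%R \o U]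
            - 'E_Q[(fun x => Num.max (- x) 0)%R \o U].
  by rewrite unlock integralE; congr (_ - _); apply: eq_integral => x _ /=;
    rewrite ?funeposE ?funenegE/= -?EFin_max.
have mid : measurable_fun setT (fun x : R => x) by exact: measurable_id.
have mN : measurable_fun setT (fun x : R => - x)%R by exact: oppr_measurable.
have m0 : measurable_fun setT (fun x : R => 0%R : R) by exact: measurable_cst.
have mp := measurable_maxr mid m0.
have mn := measurable_maxr mN m0.
rewrite posE [in RHS]posE -(expectation_scaled_law XZ mp); last 2 first.
- by move=> x; rewrite le_max lexx orbT.
- by rewrite /= maxxx.
rewrite -(expectation_scaled_law XZ mn); last 2 first.
- by move=> x; rewrite le_max lexx orbT.
- by rewrite /= oppr0 maxxx.
move/Lfun1_integrable in X1.
(* Distributing [p] must avoid oo - oo: the negative part of [X] has finite expectation. *)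
rewrite -muleBr// fin_num_adde_defl// fin_numN unlock.
have := integrable_fin_num measurableT (integrable_funeneg measurableT X1).
by under eq_integral do rewrite funenegE/= -EFin_max.
Qed.

(** * Variance of sums and covariance under independence *)

Lemma variance_sum_uncorrelated (R : realType) d (T : measurableType d)
    (P : probability T R) (K : finType) (D : pred K) (X : K -> T -> R) :
  (forall i, D i -> X i \in Lfun P 2%:E) ->
  (forall i j, D i -> D j -> i != j -> covariance P (X i) (X j) = 0) ->
  'V_P[(fun w => \sum_(i | D i) X i w)%R] = \sum_(i | D i) 'V_P[X i].
Proof.
move=> X2 X0.
have le12 : 1 <= 2%:E :> \bar R by rewrite lee1n.
have sumE (r : seq K) : (fun w => \sum_(i <- r | D i) X i w)%R =
    (\sum_(i <- r | D i) X i)%R.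
  by apply/funext => w; rewrite fct_sumE.
have sum2 (r : seq K) : (\sum_(i <- r | D i) X i)%R \in Lfun P 2%:E.
  by apply: rpred_sum => i; exact: X2.
have cov0 i (r : seq K) : D i -> i \notin r ->
    covariance P (X i) (\sum_(j <- r | D j) X j)%R = 0.
  move=> Di; elim: r => [_|j r IHr].
    by rewrite big_nil; exact: covariance_cst_r.
  rewrite inE negb_or => /andP[ij ir]; rewrite big_cons; case: ifPn => Dj.
    by rewrite covarianceDr ?X2// X0// IHr// adde0.
  exact: IHr.
(* The enumeration has no repetition, so its head is not in its tail and [cov0] removes the cross
   term. *)
rewrite sumE; elim: (index_enum K) (index_enum_uniq K) => [_|i r IHr].
  by rewrite !big_nil; exact: variance_cst.
move=> /= /andP[ir ur]; rewrite !big_cons; case: ifPn => Di; last exact: IHr.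
by rewrite varianceD ?X2// IHr// cov0// mule0 adde0.
Qed.

(** The joint law of [X] and [Z] is the product of their laws, so Fubini's theorem gives E[XZ] =
    E[X] E[Z]. *)
Lemma covariance_indep0 (R : realType) d (T : measurableType d)
    (P : probability T R) (X Z : {RV P >-> R}) :
  (X : T -> R) \in Lfun P 2%:E -> (Z : T -> R) \in Lfun P 2%:E ->
  (forall E F : set R, measurable E -> measurable F ->
    P (X @^-1` E `&` Z @^-1` F) = P (X @^-1` E) * P (Z @^-1` F)) ->
  covariance P X Z = 0.
Proof.
move=> X2 Z2 XZ.
have PT : P [set: T] \is a fin_num := fin_num_measure P _ measurableT.
have X1 := Lfun_subset12 PT X2.
have Z1 := Lfun_subset12 PT Z2.
have XZ1 := Lfun2_mul_Lfun1 X2 Z2.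
rewrite covarianceE//; suff -> : 'E_P[X * Z] = 'E_P[X] * 'E_P[Z].
  by rewrite subee// fin_numM// expectation_fin_num.
pose m1 := distribution P X.
pose m2 := distribution P Z.
have mXZ : measurable_fun [set: T] (fun w => (X w, Z w)).
  by apply/measurable_fun_pairP.
pose f (z : R * R) := (z.1 * z.2)%:E.
have mf : measurable_fun [set: R * R] f.
  by apply/measurable_EFinP; exact: measurable_funM.
(* The product measure is determined by its values on measurable rectangles. *)
have jointE E : measurable E ->
    (m1 \x m2) E = pushforward P (fun w => (X w, Z w)) E.
  apply: product_measure_unique => A B mA mB.
  by rewrite /pushforward/= -XZ.
have fint : P.-integrable setT (f \o (fun w => (X w, Z w))).
  exact/Lfun1_integrable.
have E12 : 'E_P[X * Z] = \int[m1 \x m2]_z f z.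
  rewrite (eq_measure_integral (pushforward P (fun w => (X w, Z w)))).
    by rewrite integral_pushforward// unlock.
  by move=> E mE _; exact: jointE.
(* Fubini's theorem needs integrability under the product law; it is transferred from that of
   [X * Z]. *)
have fint' : (m1 \x m2).-integrable setT f.
  apply/integrableP; split => //.
  rewrite (eq_measure_integral (pushforward P (fun w => (X w, Z w)))).
    by have /integrableP[] := integrable_pushforward mXZ mf fint measurableT.
  by move=> E mE _; exact: jointE.
rewrite E12 -integral12_prod_meas1//.
have mE : measurable_fun [set: R] (@EFin R) by exact/measurable_EFinP.
have integrable_law (U : {RV P >-> R}) : (U : T -> R) \in Lfun P 1 ->
    (distribution P U).-integrable [set: R] (@EFin R).
  by move=> /Lfun1_integrable U1; exact: integrable_pushforward.
have integral_law (U : {RV P >-> R}) : (U : T -> R) \in Lfun P 1 ->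
    \int[distribution P U]_x x%:E = 'E_P[U].
  by move=> /Lfun1_integrable U1; rewrite integral_distribution// unlock.
(* The inner integral at x is x E[Z]; integrating over x leaves E[X] E[Z]. *)
rewrite -(integral_law X)// -(fineK (expectation_fin_num Z1)).
rewrite -integralZr//; last exact: integrable_law.
apply: eq_integral => x _; rewrite /fubini_F /f/=.
under eq_integral do rewrite EFinM.
rewrite integralZl//; last exact: integrable_law.
by rewrite integral_law ?fineK ?expectation_fin_num.
Qed.

(** * Bound for a single term, vanishing covariances, square integrability *)

Lemma variance_scaled_law (R : realType) d1 d2 (T1 : measurableType d1)
    (T2 : measurableType d2) (P1 : probability T1 R) (P2 : probability T2 R)
    (X : {RV P1 >-> R}) (Z : {RV P2 >-> R}) (p : {nonneg R}) :
  (p%:num <= 1)%R ->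
  (forall E : set R, measurable E -> ~ E 0%R ->
    p%:num%:E * distribution P1 X E = distribution P2 Z E) ->
  (X : T1 -> R) \in Lfun P1 2%:E -> (Z : T2 -> R) \in Lfun P2 2%:E ->
  'V_P1[(p%:num \o* X)%R] <= p%:num%:E * 'V_P2[Z].
Proof.
move=> p1 XZ X2 Z2.
have X1 := Lfun_subset12 (fin_num_measure P1 _ measurableT) X2.
have msqr : measurable_fun setT (fun x : R => x ^+ 2)%R.
  exact: measurable_funX.
have E1 := expectation_scaled_law_id XZ X1.
have := expectation_scaled_law XZ msqr (fun x => sqr_ge0 x) (expr0n _ 2).
rewrite -[_ \o X]/((X : T1 -> R) ^+ 2)%R -[_ \o Z]/((Z : T2 -> R) ^+ 2)%R => E2.
rewrite varianceZ// !varianceE// -E1 -E2.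
have /fineK <- := expectation_fin_num X1.
have /fineK <- : 'E_P1[(X : T1 -> R) ^+ 2] \is a fin_num.
  by apply: expectation_fin_num; exact: Lfun2_mul_Lfun1.
rewrite !expe2 -!EFinM lee_fin.
have p0 : (0 <= p%:num)%R by [].
set a := fine _; set b := fine _; set q := p%:num.
(* Here [b] is the mean of [X]; its second moment [a] has coefficient [q ^+ 2] on both sides and
   cancels. *)
rewrite -subr_ge0 (_ : _ - _ = q ^+ 2 * b ^+ 2 * (1 - q))%R; last by ring.
by rewrite mulr_ge0 ?subr_ge0// mulr_ge0 ?sqr_ge0.
Qed.

Lemma mutually_independent_covariance0 (R : realType) d (T : measurableType d)
    (Q : probability T R) (K : finType) (D : {set K}) (X : K -> {RV Q >-> R})
    i j :
  mutually_independent D X -> i \in D -> j \in D -> i != j ->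
  (X i : T -> R) \in Lfun Q 2%:E -> (X j : T -> R) \in Lfun Q 2%:E ->
  covariance Q (X i) (X j) = 0.
Proof.
move=> indX iD jD ij Xi2 Xj2; apply: covariance_indep0 => // E F mE mF.
(* Mutual independence is used on the pair of indices [i] and [j], with [E] at [i] and [F] at
   [j]. *)
pose G k := if k == i then E else F.
have Gi : G i = E by rewrite /G eqxx.
have Gj : G j = F by rewrite /G eq_sym (negbTE ij).
have sD : [set i; j]%SET \subset D
  by apply/fintype.subsetP => k; rewrite !inE => /orP[] /eqP ->.
have mG k : k \in [set i; j]%SET -> measurable (G k).
  by rewrite /G; case: ifPn.
have := indX [set i; j]%SET G sD mG.
rewrite big_setU1 ?inE// big_set1 Gi Gj => <-; congr (Q _).
apply/seteqP; split => [w [wE wF] k /=|w h]; last first.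
  by split; rewrite -?Gi -?Gj; apply: h; rewrite /= !inE eqxx ?orbT.
by rewrite !inE => /orP[] /eqP ->; rewrite ?Gi ?Gj.
Qed.

(** The second moment is an integral against the law, hence the same for [Z] and [X]. *)
Lemma has_law_of_Lfun2 (R : realType) d1 d2 (T1 : measurableType d1)
    (T2 : measurableType d2) (Q : probability T1 R) (P : probability T2 R)
    (Z : {RV Q >-> R}) (X : T2 -> R) :
  has_law_of Z P X -> X \in Lfun P 2%:E -> (Z : T1 -> R) \in Lfun Q 2%:E.
Proof.
move=> ZX X2; have mX : measurable_fun setT X.
  by have := sub_Lfun_mfun X2; rewrite inE.
have msqr : measurable_fun [set: R] (fun x => (x ^+ 2)%:E).
  by apply/measurable_EFinP; exact: measurable_funX.
have sqr_ge0E (x : R) : 0 <= (x ^+ 2)%:E by rewrite lee_fin sqr_ge0.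
apply/Lfun2P => //; move/(Lfun2P P mX) : X2; apply: le_lt_trans.
have <- := ge0_integral_distribution Z msqr sqr_ge0E.
rewrite (eq_measure_integral (pushforward P X)); last first.
  by move=> E mE _; exact: ZX.
by rewrite ge0_integral_pushforward.
Qed.

(** * Comparison of the two estimators *)

Theorem proposition3 (R : realType)
    (disp : measure_display) (T : measurableType disp) (P : probability T R)
    (d n : nat) (A : 'I_d -> set T) (Y : {RV P >-> R})
    (disp1 : measure_display) (T1 : measurableType disp1)
    (Q1 : probability T1 R) (W : {set 'I_d} -> {RV Q1 >-> R})
    (disp2 : measure_display) (T2 : measurableType disp2)
    (Q2 : probability T2 R) (V : {set 'I_d} -> {RV Q2 >-> R})
    (mA : forall i, measurable (A i))
    (Y2 : (Y : T -> R) \in Lfun P 2%:E)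
    (n_range : (1 <= n <= d)%N)
    (PB_gt0 : forall I : {set 'I_d}, #|I| = n -> 0 < P (B_ A I))
    (W_indep : mutually_independent [set I : {set 'I_d} | #|I| == n]%SET W)
    (W_law : forall I : {set 'I_d}, #|I| = n ->
      has_law_of (W I) (cond_prob P (B_ A I))
        (fun t => Y t * \1_(C_ A I) t)%R)
    (V_indep : mutually_independent [set I : {set 'I_d} | #|I| == n]%SET V)
    (V_law : forall I : {set 'I_d}, #|I| = n ->
      has_law_of (V I) P (fun t => Y t * \1_(B_ A I `&` C_ A I) t)%R) :
  'V_Q1[(fun w => \sum_(I : {set 'I_d} | #|I| == n)
                    fine (P (B_ A I)) * W I w)%R]
  <= \big[maxe/-oo]_(I : {set 'I_d} | #|I| == n) P (B_ A I)
     * 'V_Q2[(fun w => \sum_(I : {set 'I_d} | #|I| == n) V I w)%R].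
Proof.
have mB I : measurable (B_ A I).
  by apply: fin_bigcap_measurable => // i _; exact: mA.
have mC I : measurable (C_ A I).
  by apply: fin_bigcap_measurable => // i _; apply: measurableC; exact: mA.
pose p I : {nonneg R} := NngNum (fine_ge0 (measure_ge0 P (B_ A I))).
have pE I : (p I)%:num%:E = P (B_ A I) by rewrite /= fineK// fin_num_measure.
(* The factor P(B_I) cancels the denominator of the conditional probability, which leaves an
   equality of two events. *)
have scaled_law (I : {set 'I_d}) : #|I| = n ->
    forall E : set R, measurable E -> ~ E 0%R ->
    (p I)%:num%:E * distribution Q1 (W I) E = distribution Q2 (V I) E.
  move=> cI E mE E0; rewrite W_law// V_law// pE /pushforward /cond_prob.
  rewrite muleC -muleA [_^-1 * _]muleC divee ?mule1 ?gt_eqF ?PB_gt0//;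
    last by rewrite fin_num_measure.
  congr (P _); apply/seteqP; split => t /=.
    by move=> [tE tB]; rewrite indicI/= indicE mem_set// mul1r.
  (* On B_I the two indicators agree; off B_I the variable is 0, a value that [E] excludes. *)
  have [tB|tB] := pselect (B_ A I t).
    by rewrite indicI/= [\1_(B_ A I) t]indicE mem_set// mul1r.
  by rewrite indicI/= [\1_(B_ A I) t]indicE memNset// mul0r mulr0.
have V2 (I : {set 'I_d}) : #|I| = n -> (V I : T2 -> R) \in Lfun Q2 2%:E.
  move=> cI; apply: (has_law_of_Lfun2 (P := P) (V_law I cI)).
  set S := _ `&` _; have mS : measurable S by exact: measurableI.
  have mYS : measurable_fun setT (fun t => Y t * \1_S t)%R.
    by apply: measurable_funM => //; exact: measurable_indic.
  apply/Lfun2P => //; move: Y2 => /Lfun2P -/(_ _)/le_lt_trans; apply => //.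
  apply: ge0_le_integral => //.
  - by move=> t _; rewrite lee_fin sqr_ge0.
  - by apply/measurable_EFinP; exact: measurable_funX.
  - by apply/measurable_EFinP; exact: measurable_funX.
  - by move=> t _; rewrite lee_fin exprMn ler_piMr ?sqr_ge0.
(* The law of [W I] comes from the bare set function [cond_prob], so finiteness is drawn from [V I]:
   P(B_I) E[W_I^2] = E[V_I^2] is finite and P(B_I) > 0. *)
have W2 (I : {set 'I_d}) : #|I| = n -> (W I : T1 -> R) \in Lfun Q1 2%:E.
  move=> cI; apply/Lfun2P => //.
  have msqr : measurable_fun setT (fun x : R => x ^+ 2)%R.
    exact: measurable_funX.
  have EV2 := expectation_scaled_law (scaled_law I cI) msqr
    (fun x => sqr_ge0 x) (expr0n _ 2).
  have := (Lfun2P Q2 (measurable_funPT (V I))).1 (V2 I cI).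
  move: EV2; rewrite unlock => <-.
  move=> pW2oo; rewrite ltNge leye_eq; apply/eqP => Woo.
  by move: pW2oo; rewrite Woo gt0_muley ?ltxx// pE PB_gt0.
rewrite (_ : (fun w => _) = (fun w => \sum_(I : {set 'I_d} | #|I| == n)
    ((p I)%:num \o* W I) w)%R); last first.
  by apply/funext => w; apply: eq_bigr => I _; rewrite /= mulrC.
rewrite !variance_sum_uncorrelated; last 4 first.
- by move=> I /eqP cI; exact: V2.
- move=> I J /eqP cI /eqP cJ IJ.
  apply: (mutually_independent_covariance0 V_indep) => //; rewrite ?V2//.
  - by rewrite inE cI.
  - by rewrite inE cJ.
- by move=> I /eqP cI; apply: Lfun_scale; rewrite ?ler1n ?W2.
- move=> I J /eqP cI /eqP cJ IJ.
  have I2 := W2 _ cI; have J2 := W2 _ cJ.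
  have I1 := Lfun_subset12 (fin_num_measure Q1 _ measurableT) I2.
  have J1 := Lfun_subset12 (fin_num_measure Q1 _ measurableT) J2.
  have pJ1 : ((p J)%:num \o* W J)%R \in Lfun Q1 1 by exact: Lfun_scale.
  rewrite covarianceZl//; last first.
    by apply: Lfun2_mul_Lfun1 => //; apply: Lfun_scale; rewrite ?ler1n.
  rewrite covarianceZr//; last exact: Lfun2_mul_Lfun1.
  rewrite (mutually_independent_covariance0 W_indep) ?mule0//.
  - by rewrite inE cI.
  - by rewrite inE cJ.
(* Variances are nonnegative, so the maximum distributes over the sum and the bound can be proved
   term by term. *)
rewrite ge0_sume_distrr; last by move=> I _; exact: variance_ge0.
apply: lee_sum => I /eqP cI.
apply: (@le_trans _ _ (P (B_ A I) * 'V_Q2[V I])).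
  rewrite -pE; apply: variance_scaled_law;
    [|exact: scaled_law|exact: W2|exact: V2].
  by rewrite -lee_fin pE probability_le1.
rewrite lee_wpmul2r ?variance_ge0//.
(* [I] belongs to the range of the maximum, whose default [-oo] is neutral for [maxe]. *)
rewrite (@le_bigmax_cond _ _ _ -oo _ (fun J : {set 'I_d} => #|J| == n))//.
exact/eqP.
Qed.
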